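(* Let $\mathcal{H}$ be a separable Hilbert space and let $\{f_n\}_{n\in\mathbb{Z}}$ be a frame of $\mathcal{H}$ such that $\{f_n\}_{n\in\mathbb{Z}}=\{T^nf_0\}_{n\in\mathbb{Z}}$ for some $T\in GL(\mathcal{H})$. The following statements hold. (i) If $T^s$ is normal for some $s\in\mathbb{Z}$, then $T^s$ is unitary. (ii) A power $(T^* )^s$ of $T^*$ with $s\in\mathbb{Z}$ cannot be equal to a polynomial $p(T)$ in $T$. In particular, $T$ cannot be self-adjoint.
   Context: A sequence $\{f_n\}_{n\in\mathbb{Z}}$ in a separable Hilbert space $\mathcal{H}$ with inner product $\langle\cdot,\cdot\rangle$ and norm $\|\cdot\|$ is a frame of $\mathcal{H}$ if there exist $A,B>0$ with $A\|f\|^2\le\sum_{n\in\mathbb{Z}}|\langle f,f_n\rangle|^2\le B\|f\|^2$ for all $f\in\mathcal{H}$. $GL(\mathcal{H})$ is the set of bounded linear operators $T:\mathcal{H}\to\mathcal{H}$ that are bijective (hence with bounded inverse). The equality $\{f_n\}_{n\in\mathbb{Z}}=\{T^nf_0\}_{n\in\mathbb{Z}}$ means $f_n=T^nf_0$ for every $n\in\mathbb{Z}$. $T^*$ denotes the adjoint of $T$. A polynomial $p(T)$ in $T$ is a finite sum $\sum_{k=0}^{d}c_kT^k$ with scalar coefficients $c_k$.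
   Formalization: In (ii), H is assumed nonzero (on H={0}, T=0 is self-adjoint), and for s≤0 the polynomial p(T)=T^{|s|} is excluded, since (T* )^0=I and (T* )^s=T^{|s|} whenever T is unitary, e.g. the bilateral shift on l²(Z). For s>0 all polynomials are covered. *)

(* Defs.v *)
From HB Require Import structures.
From mathcomp Require Import all_boot all_order all_algebra.
From mathcomp Require Import complex sesquilinear.
From mathcomp Require Import all_classical all_reals all_analysis.

Set Implicit Arguments.
Unset Strict Implicit.
Unset Printing Implicit Defensive.
Import Order.TTheory GRing.Theory Num.Theory numFieldNormedType.Exports.

Local Open Scope classical_set_scope.
Local Open Scope ring_scope.

(* The scalars are either R or R[i]: everything below covers both real and
   complex Hilbert spaces. *)
Variant scalars := RealScalars | ComplexScalars.

Definition scalar_field (R : realType) (F : scalars) : numFieldType :=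
  match F with
  | RealScalars => R
  | ComplexScalars => R[i]
  end.

Definition scalar_conj (R : realType) (F : scalars) :
    scalar_field R F -> scalar_field R F :=
  match F return scalar_field R F -> scalar_field R F with
  | RealScalars => fun x => x
  | ComplexScalars => fun z : R[i] => (z^*)%R
  end.

Definition scalar_re (R : realType) (F : scalars) : scalar_field R F -> R :=
  match F return scalar_field R F -> R with
  | RealScalars => fun x => x
  | ComplexScalars => fun z : R[i] => complex.Re z
  end.

(* The library norms of a normed module over K and of K itself are K-valued
   (with real values); [nrm] and [absv] are the same numbers as elements
   of R. *)
Definition nrm (R : realType) (F : scalars)
    (H : normedModType (scalar_field R F)) (x : H) : R := scalar_re `|x|.

Definition absv (R : realType) (F : scalars) (z : scalar_field R F) : R :=
  scalar_re `|z|.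

Definition separable (H : topologicalType) : Prop :=
  exists S : set H, countable S /\ dense S.

Section Operators.
Variables (R : realType) (F : scalars).
Variable H : completeNormedModType (scalar_field R F).
Implicit Types (T : H -> H) (x y : H).

Definition bounded_op T : Prop :=
  exists M : R, forall x, nrm (T x) <= M * nrm x.

Definition GL (T : {linear H -> H}) : Prop := bounded_op T /\ bijective T.

(* The inverse is total; it is meaningful only when T is bijective. *)
Definition zpow T (s : int) : H -> H :=
  match s with
  | Posz n => iter n T
  | Negz n => iter n.+1 ('pinv_(fun=> 0) [set: H] T)
  end.

Definition poly_op (p : {poly scalar_field R F}) T : H -> H :=
  fun x => \sum_(k < size p) p`_k *: iter k T x.

Section InnerProduct.
Variable dot : {dot H for @scalar_conj R F}.

(* T^* y is the unique z with <T x, y> = <x, z> for all x; it exists for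
   every bounded linear T by the Riesz representation theorem. *)
Definition adjoint T : H -> H :=
  fun y => xget 0 [set z | forall x, dot (T x) y = dot x z].

Definition normal_op T : Prop := T \o adjoint T = adjoint T \o T.

Definition unitary_op T : Prop :=
  T \o adjoint T = id /\ adjoint T \o T = id.

Definition self_adjoint T : Prop := adjoint T = T.

Definition frame (f : int -> H) : Prop :=
  exists A B : R, [/\ 0 < A, 0 < B & forall g : H,
    ((A * nrm g ^+ 2)%:E <= \esum_(n in [set: int])
                              (absv (dot g (f n)) ^+ 2)%:E)%E /\
    (\esum_(n in [set: int])
       (absv (dot g (f n)) ^+ 2)%:E <= (B * nrm g ^+ 2)%:E)%E].

End InnerProduct.
End Operators.

(* Main.v *)
Require Import Defs.
From HB Require Import structures.
From mathcomp Require Import all_boot all_order all_algebra.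
From mathcomp Require Import complex sesquilinear.
From mathcomp Require Import all_classical all_reals all_analysis.
From mathcomp Require Import finmap ring lra zify.

Set Implicit Arguments.
Unset Strict Implicit.
Unset Printing Implicit Defensive.
Import Order.TTheory GRing.Theory Num.Theory numFieldNormedType.Exports.

Local Open Scope classical_set_scope.
Local Open Scope ring_scope.

(** Write [f n = T^n f_0], let [T*] be the adjoint of [T], and let
    [energy g] be the sum of the [|<g, f n>|^2].  The frame inequalities say
    that [energy] is equivalent to the squared norm.  Since [T^s] moves [f n] to
    [f (n + s)], the numbers [<(T* )^s g, f n> = <g, T^s (f n)>] are those of
    [g] up to a shift of the index, so every power of [T*] preserves
    [energy] ([energy_shift]).  Hence all powers of [T*], positive and negative, are
    bounded by the same constant.

    (i) If [N] is normal and [b_k] is the squared norm of [(N* )^k x], then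
    [2 b_(k+1) <= b_k + b_(k+2)], because [b_(k+1)] is an inner product of two
    vectors whose squared norms are [b_k] and [b_(k+2)].  A bounded convex
    sequence does not increase at its start, so [|N* x| <= |x|]
    ([normal_power_bounded_contraction]).  For [N = T^s] the same applies to
    [T^(-s)], so [N*] is isometric and, being normal, [N] is unitary.

    (ii) If [(T* )^s = p(T)] then [(T* )^s] commutes with [T^s], so [T^s] is
    unitary by (i) and [T^s p(T) = 1].  Evaluated on the orbit, this is a
    nontrivial linear recurrence with constant coefficients satisfied by
    [n |-> <f n, g>], for every [g].  That sequence is square summable over
    all the integers, hence tends to 0 in both directions; peeling off the
    complex roots of the characteristic polynomial reduces to a two-sided
    geometric sequence, which tends to 0 at both ends only if it is 0
    ([null_recurrence]).  So [g] is orthogonal to all [f n] and the lower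
    frame bound gives [g = 0].

    Two facts about bounded operators underlie all this: that [T*] exists,
    and that it is bijective, so that its negative powers make sense.  Both
    are instances of one representation theorem ([representation]): if [V] is
    bounded and bounded below then every bounded functional has the form
    [x |-> <V x, V w>].  With [V] the identity this is the theorem of Riesz;
    with [V = T*], which is bounded below by the frame inequalities, it says
    that [T T*] is onto.  Everything about norms is done with the real part
    of the inner product, so that real and complex scalars are treated
    alike. *)

(** * Real and complex scalars *)

Section Scalars.
Variables (R : realType) (F : scalars).
Notation K := (scalar_field R F).

Definition scalar_of_real : R -> K :=
  match F return R -> scalar_field R F with
  | RealScalars => fun a => a
  | ComplexScalars => fun a => (a%:C)%C
  end.

Lemma scalar_reD (x y : K) : scalar_re (x + y) = scalar_re x + scalar_re y.
Proof. by rewrite /scalar_re; case: F x y => //= -[a b] [c d]. Qed.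

Lemma scalar_reN (x : K) : scalar_re (- x) = - scalar_re x.
Proof. by rewrite /scalar_re; case: F x => //= -[a b]. Qed.

Lemma scalar_re1 : scalar_re (1 : K) = 1.
Proof. by rewrite /scalar_re; case: F. Qed.

Lemma scalar_of_real0 : scalar_of_real 0 = 0.
Proof. by rewrite /scalar_of_real; case: F. Qed.

Lemma scalar_re_conj (x : K) : scalar_re (scalar_conj x) = scalar_re x.
Proof. by rewrite /scalar_re /scalar_conj; case: F x => //= -[a b]. Qed.

Lemma scalar_re_realM a (x : K) :
  scalar_re (scalar_of_real a * x) = a * scalar_re x.
Proof.
rewrite /scalar_re /scalar_of_real; case: F x => //= -[b c] /=.
by rewrite mul0r subr0.
Qed.

Lemma scalar_re_real a : scalar_re (scalar_of_real a) = a.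
Proof. by rewrite /scalar_re /scalar_of_real; case: F. Qed.

Lemma ler_scalar_of_real a b : (scalar_of_real a <= scalar_of_real b) = (a <= b).
Proof. by rewrite /scalar_of_real; case: F => //; rewrite lecR. Qed.

Lemma ltr_scalar_of_real a b : (scalar_of_real a < scalar_of_real b) = (a < b).
Proof. by rewrite /scalar_of_real; case: F => //; rewrite ltcR. Qed.

Lemma scalar_of_real_re (x : K) : 0 <= x -> scalar_of_real (scalar_re x) = x.
Proof.
rewrite /scalar_re /scalar_of_real; case: F x => //= -[a b] /=.
by rewrite lecE /= => /andP[/eqP -> _].
Qed.

Lemma scalar_absv_real (x : K) : scalar_of_real (absv x) = `|x|.
Proof. by rewrite /absv scalar_of_real_re. Qed.

Lemma absv0 : absv (0 : K) = 0.
Proof. by rewrite /absv normr0 /scalar_re; case: F. Qed.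

Lemma absv_conj (x : K) : absv (scalar_conj x) = absv x.
Proof.
rewrite /absv /scalar_re /scalar_conj.
by case: F x => //= -[a b] /=; rewrite sqrrN.
Qed.

End Scalars.

(** * The real part of the inner product *)

Lemma discriminant_le (R : realFieldType) (a b d : R) : 0 <= a -> 0 <= b ->
  (forall t, 0 <= a ^+ 2 + 2 * t * d + t ^+ 2 * b ^+ 2) -> `|d| <= a * b.
Proof.
move=> a0 b0 q.
rewrite -ler_sqr ?nnegrE ?mulr_ge0 // -normrX ger0_norm ?sqr_ge0 //.
have [b1|b1] := eqVneq b 0.
  rewrite b1 mulr0 expr0n /=; have [-> |d0] := eqVneq d 0; first by rewrite expr0n.
  (* The polynomial is affine with slope [2 d]: this is where it equals -1. *)
  have := q (- (a ^+ 2 + 1) / (2 * d)); rewrite b1.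
  have -> : a ^+ 2 + 2 * (- (a ^+ 2 + 1) / (2 * d)) * d
     + (- (a ^+ 2 + 1) / (2 * d)) ^+ 2 * 0 ^+ 2 = - 1 :> R by field.
  by lra.
have b2 : 0 < b ^+ 2 by rewrite exprn_even_gt0.
have : 0 <= b ^+ 2 * (a ^+ 2 + 2 * (- d / b ^+ 2) * d + (- d / b ^+ 2) ^+ 2 * b ^+ 2).
  by rewrite mulr_ge0 // ltW.
have -> : b ^+ 2 * (a ^+ 2 + 2 * (- d / b ^+ 2) * d + (- d / b ^+ 2) ^+ 2 * b ^+ 2)
    = (a * b) ^+ 2 - d ^+ 2 by field.
by rewrite subr_ge0.
Qed.

Section RealInnerProduct.
Variables (R : realType) (F : scalars).
Notation K := (scalar_field R F).
Variable H : completeNormedModType K.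
Variable dot : {dot H for @scalar_conj R F}.
Hypothesis dot_norm : forall x : H, `|x| ^+ 2 = dot x x.

Definition rdot (x y : H) : R := scalar_re (dot x y).

Lemma dotC x y : dot x y = scalar_conj (dot y x).
Proof. by case: dot => op [? ? [E]] /=; rewrite E expr0 mul1r. Qed.

Lemma rdotC x y : rdot x y = rdot y x.
Proof. by rewrite /rdot dotC scalar_re_conj. Qed.

Lemma dotDl (x y z : H) : dot (x + y) z = dot x z + dot y z.
Proof. by rewrite linearDl. Qed.

Lemma rdotDl x y z : rdot (x + y) z = rdot x z + rdot y z.
Proof. by rewrite /rdot dotDl scalar_reD. Qed.

Lemma rdotDr x y z : rdot z (x + y) = rdot z x + rdot z y.
Proof. by rewrite !(rdotC z) rdotDl. Qed.

Lemma rdotNl x z : rdot (- x) z = - rdot x z.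
Proof. by rewrite /rdot linearNl scalar_reN. Qed.

Lemma rdotNr x z : rdot z (- x) = - rdot z x.
Proof. by rewrite !(rdotC z) rdotNl. Qed.

Lemma dotZl (a : K) (x y : H) : dot (a *: x) y = a * dot x y.
Proof. exact: linearZl_LR. Qed.

Lemma rdotZl a x y : rdot (scalar_of_real F a *: x) y = a * rdot x y.
Proof. by rewrite /rdot dotZl scalar_re_realM. Qed.

Lemma rdotZr a x y : rdot y (scalar_of_real F a *: x) = a * rdot y x.
Proof. by rewrite !(rdotC y) rdotZl. Qed.

Lemma nrm_real (x : H) : scalar_of_real F (nrm x) = `|x|.
Proof. by rewrite /nrm scalar_of_real_re. Qed.

Lemma nrm_ge0 (x : H) : 0 <= nrm x.
Proof.
rewrite -(ler_scalar_of_real F) nrm_real.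
by rewrite scalar_of_real0.
Qed.

Lemma rdotxx x : rdot x x = nrm x ^+ 2.
Proof.
rewrite /rdot -dot_norm -nrm_real expr2 scalar_re_realM.
by rewrite scalar_re_real.
Qed.

Lemma nrm_eq0 (x : H) : nrm x = 0 -> x = 0.
Proof.
by move=> x0; apply/eqP; rewrite -normr_eq0 -nrm_real x0 scalar_of_real0.
Qed.

Lemma rdot_inj y z : (forall x, rdot x y = rdot x z) -> y = z.
Proof.
move=> yz; apply/subr0_eq/nrm_eq0/eqP; rewrite -sqrf_eq0 -rdotxx.
by rewrite [_ (_ - _)]rdotDr rdotNr yz subrr.
Qed.

Lemma rdot_CS x y : `|rdot x y| <= nrm x * nrm y.
Proof.
apply: discriminant_le => [||t]; [exact: nrm_ge0 | exact: nrm_ge0 |].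
have : 0 <= rdot (x + scalar_of_real F t *: y) (x + scalar_of_real F t *: y).
  by rewrite rdotxx sqr_ge0.
rewrite !(rdotDl, rdotDr) !(rdotZl, rdotZr) (rdotC y x) !rdotxx; lra.
Qed.

(** The real part determines the scalar: test the difference [d] of the two
    sides against the multiple [d^-1]. *)
Lemma dot_inj_re x y x' y' :
  (forall a, rdot (a *: x) y = rdot (a *: x') y') -> dot x y = dot x' y'.
Proof.
move=> e; apply/subr0_eq/eqP/negPn/negP => n0.
set d := dot x y - dot x' y' in n0.
have := e d^-1; rewrite /rdot !dotZl => /eqP; rewrite -subr_eq0.
by rewrite -scalar_reN -scalar_reD -mulrBr mulVf // scalar_re1 oner_eq0.
Qed.

End RealInnerProduct.

(** * Representation of bounded functionals *)

Section Riesz.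
Variables (R : realType) (F : scalars).
Notation K := (scalar_field R F).
Variable H : completeNormedModType K.
Variable dot : {dot H for @scalar_conj R F}.
Hypothesis dot_norm : forall x : H, `|x| ^+ 2 = dot x x.
Notation "''[' x , y ]" := (rdot dot x y).

(** Completeness with radii in [R] rather than in the field of scalars. *)
Lemma nrm_complete (u : nat -> H) :
  (forall e : R, 0 < e -> exists N, forall n m, (N <= n)%N -> (N <= m)%N ->
    nrm (u n - u m) < e) ->
  exists w, forall e : R, 0 < e -> exists N, forall n, (N <= n)%N ->
    nrm (u n - w) < e.
Proof.
move=> cu.
have epos (e : K) : 0 < e -> 0 < scalar_re e.
  move=> e0; rewrite -(ltr_scalar_of_real F) scalar_of_real0.
  by rewrite scalar_of_real_re ?ltW.
have ltE (x : H) (e : K) : 0 < e -> (nrm x < scalar_re e) = (`|x| < e).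
  move=> e0; rewrite -[in RHS](scalar_of_real_re (ltW e0)) -nrm_real.
  by rewrite ltr_scalar_of_real.
have : cvgn u.
  apply: cauchy_cvg; apply: cauchy_exP => e e0.
  have [N cN] := cu _ (epos _ e0).
  exists (u N); exists N => //= n Nn.
  by rewrite -ball_normE /= -ltE // cN.
move=> /cvgrPdist_lt uw; exists (limn u) => e e0.
have e0' : 0 < scalar_of_real F e.
  by rewrite -(scalar_of_real0 R F) ltr_scalar_of_real.
have [N _ wN] := uw _ e0'; exists N => n /wN /=.
by rewrite distrC -ltE // scalar_re_real.
Qed.

Variables (V : H -> H) (c M : R).
Hypothesis VD : {morph V : x y / x + y}.
Hypothesis VZ : forall a x, V (scalar_of_real F a *: x) = scalar_of_real F a *: V x.
Hypothesis c_gt0 : 0 < c.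
Hypothesis V_ge : forall x, c * nrm x <= nrm (V x).
Hypothesis V_le : forall x, nrm (V x) <= M * nrm x.
Variables (phi : H -> R) (L : R).
Hypothesis phiD : {morph phi : x y / x + y}.
Hypothesis phiZ : forall a x, phi (scalar_of_real F a *: x) = a * phi x.
Hypothesis phi_le : forall x, phi x <= L * nrm x.

(** A minimiser of [J] represents [phi]: the derivative of [J] at [x] in the
    direction [y] is [2 * ('[V x, V y] - phi y)]. *)
Let J x := nrm (V x) ^+ 2 - 2 * phi x.

Let J_line x y t :
  J (x + scalar_of_real F t *: y) =
  J x + 2 * t * ('[ V x, V y] - phi y) + t ^+ 2 * nrm (V y) ^+ 2.
Proof.
rewrite /J VD VZ phiD phiZ -!(rdotxx dot_norm) !(rdotDl, rdotDr) !(rdotZl, rdotZr).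
by rewrite (rdotC _ (V y) (V x)); ring.
Qed.

(** By the bounds on [V] and [phi], [J x] is at least
    [(c * nrm x) ^+ 2 - 2 * L * nrm x], in which one completes the square. *)
Let J_lbound x : - (L / c) ^+ 2 <= J x.
Proof.
have n0 := nrm_ge0 x; have := V_ge x; have := phi_le x.
set v := nrm (V x); set n := nrm x in n0 *; set p := phi x => h1 h2.
have : (c * n) ^+ 2 <= v ^+ 2.
  by rewrite lerXn2r ?nnegrE ?nrm_ge0 ?mulr_ge0 // ltW.
have := sqr_ge0 (c * n - L / c).
have -> : (c * n - L / c) ^+ 2 = (c * n) ^+ 2 - 2 * (L * n) + (L / c) ^+ 2.
  by field; rewrite gt_eqF.
rewrite /J -/v -/p; lra.
Qed.

Let m := inf (range J).

Let J_has_inf : has_inf (range J).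
Proof.
split; first by exists (J 0), 0.
by exists (- (L / c) ^+ 2) => _ [x _ <-]; exact: J_lbound.
Qed.

Let m_le x : m <= J x.
Proof. by apply: ge_inf; [case: J_has_inf | exists x]. Qed.

(** A point where [J] is within [e ^+ 2] of its infimum solves the
    representation problem up to [e]: along each line through it [J] is a
    quadratic polynomial that goes down by at most [e ^+ 2]. *)
Let almost_critical x y e : 0 <= e -> J x <= m + e ^+ 2 ->
  `|'[ V x, V y] - phi y| <= e * nrm (V y).
Proof.
move=> e0 Jx; apply: discriminant_le => // [|t]; first exact: nrm_ge0.
by have := m_le (x + scalar_of_real F t *: y); rewrite J_line; lra.
Qed.

(** Parallelogram law: at the midpoint of two almost minimal points [J] would
    drop below its infimum if they were far apart. *)
Let almost_min_close x y e : 0 <= e -> J x <= m + e ^+ 2 -> J y <= m + e ^+ 2 ->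
  c * nrm (x - y) <= 2 * e.
Proof.
move=> e0 Jx Jy; apply: le_trans (V_ge _) _.
set d := x - y.
have x_ : x = y + scalar_of_real F 1 *: d.
  have -> : scalar_of_real F 1 = 1 by rewrite /scalar_of_real; case: F.
  by rewrite scale1r /d addrC subrK.
have := m_le (y + scalar_of_real F 2^-1 *: d).
move: Jx; rewrite x_ !J_line => Jx mid.
rewrite -ler_sqr ?nnegrE ?nrm_ge0 ?mulr_ge0 //; lra.
Qed.

(** Points at which [J] is within [e n ^+ 2] of its infimum form a Cauchy
    sequence; the limit satisfies the equation that they satisfy up to [e n]. *)
Lemma representation : exists w, forall x, phi x = '[ V x, V w].
Proof.
pose e n : R := n.+1%:R^-1.
have e0 n : 0 < e n by rewrite invr_gt0 ltr0n.
have eN (d : R) : 0 < d -> exists N, forall n, (N <= n)%N -> e n < d.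
  move=> d0; exists (Num.truncn d^-1) => n Nn.
  rewrite invf_plt ?posrE ?ltr0n //; apply: lt_le_trans (truncnS_gt _) _.
  by rewrite ler_nat.
have /choice[u uJ] n : exists x, J x <= m + e n ^+ 2.
  have [_ [x _ <-] xm] := inf_adherent (exprn_gt0 2 (e0 n)) J_has_inf.
  by exists x; rewrite ltW.
have uJ' N n : (N <= n)%N -> J (u n) <= m + e N ^+ 2.
  move=> Nn; apply: le_trans (uJ n) _; rewrite lerD2l lerXn2r ?nnegrE ?(ltW (e0 _)) //.
  by rewrite /e lef_pV2 ?posrE ?ltr0n // ler_nat.
have half0 : 0 < 2^-1 :> R by lra.
have [|w uw] := @nrm_complete u.
  move=> d d0; have [N eNd] := eN _ (mulr_gt0 (mulr_gt0 c_gt0 d0) half0).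
  exists N => n k Nn Nk.
  rewrite -(ltr_pM2l c_gt0); apply: le_lt_trans (almost_min_close _ _ _) _.
  - exact/ltW/(e0 N).
  - exact: uJ'.
  - exact: uJ'.
  by have := eNd _ (leqnn _); lra.
exists w => x; apply/eqP; rewrite -subr_eq0 rdotC -normr_le0; apply/ler_addgt0Pr => d d0.
rewrite add0r distrC.
have b0 : 0 <= nrm (V x) := nrm_ge0 _; set b := nrm (V x) in b0.
set M' := `|M| + 1; have M0 : 0 < M' by rewrite /M' ltr_wpDl.
have B0 : 0 < 2 * (b + 1) by rewrite mulr_gt0 // ltr_wpDl.
(* [n] is chosen so that both error terms are at most [d / 2]. *)
have MB0 : 0 < 2 * M' * (b + 1) by rewrite !mulr_gt0 // ltr_wpDl.
have [N1 wN1] := uw _ (divr_gt0 d0 MB0).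
have [N2 wN2] := eN _ (divr_gt0 d0 B0).
pose n := maxn N1 N2; have := wN1 n (leq_maxl _ _); have := wN2 n (leq_maxr _ _).
rewrite !ltr_pdivlMr //.
have := almost_critical x (ltW (e0 n)) (uJ n).
have : '[ V (u n - w), V x] = '[ V (u n), V x] - '[ V w, V x].
  have V0 : V 0 = 0 by apply: (@addrI _ (V 0)); rewrite -VD !addr0.
  have VN : V (- w) = - V w by apply/eqP; rewrite -addr_eq0 -VD addNr V0.
  by rewrite VD VN rdotDl rdotNl.
have := rdot_CS dot_norm (V (u n - w)) (V x); have := V_le (u n - w).
have := nrm_ge0 (u n - w); rewrite -/b.
have MM : M <= `|M| by rewrite ler_norm.
rewrite !ler_norml.
set k := nrm (u n - w); set p := '[ _ , _]; set q := '[ _ , _].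
set v := nrm (V (u n - w)); set r := '[ V w, _].
move=> k0 vM h1 h2 h3 h4 h5.
have vb : v * b <= M' * k * b.
  by rewrite ler_wpM2r //; apply: le_trans vM _; rewrite ler_wpM2r // /M'; lra.
have kb : 0 <= M' * k by rewrite mulr_ge0 // ltW.
have := e0 n; nra.
Qed.

End Riesz.

(** * Integer powers, adjoints and normal operators *)

Section Zpow.
Variables (R : realType) (F : scalars).
Variable H : completeNormedModType (scalar_field R F).
Variable T : H -> H.
Hypothesis T_bij : bijective T.

Lemma pinvK_bij : cancel ('pinv_(fun=> 0) [set: H] T) T.
Proof.
move=> x; apply: pinvK; apply/mem_set.
by case: T_bij => g _ gK; exists (g x).
Qed.

(** The case [s = -1] is where the two clauses of [zpow] meet. *)
Lemma zpowS s x : zpow T (s + 1) x = T (zpow T s x).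
Proof.
case: s => [n|[|n]].
- by have -> : Posz n + 1 = n.+1 by lia.
- by rewrite /= pinvK_bij.
have -> : Negz n.+1 + 1 = Negz n by rewrite !NegzE; lia.
by rewrite /= pinvK_bij.
Qed.

Lemma zpowD s t x : zpow T (s + t) x = zpow T s (zpow T t x).
Proof.
elim: s x => [x|n IH x|n IH x]; first by rewrite add0r.
  by rewrite intS (addrC 1) addrAC zpowS // IH -zpowS.
apply: (bij_inj T_bij); rewrite -!zpowS addrAC.
by have -> : - n.+1%:Z + 1 = - n%:Z by lia.
Qed.

Lemma zpowK s : cancel (zpow T s) (zpow T (- s)).
Proof. by move=> x; rewrite -zpowD addNr. Qed.

End Zpow.

Section Adjoints.
Variables (R : realType) (F : scalars).
Notation K := (scalar_field R F).
Variable H : completeNormedModType K.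
Variable dot : {dot H for @scalar_conj R F}.
Hypothesis dot_norm : forall x : H, `|x| ^+ 2 = dot x x.
Implicit Types V W : H -> H.

Definition adjoint_pair V V' := forall x y, dot (V x) y = dot x (V' y).

Lemma adjoint_pair_sym V V' : adjoint_pair V V' -> adjoint_pair V' V.
Proof. by move=> VV' x y; rewrite dotC -VV' -dotC. Qed.

Lemma adjoint_pairD V V' : adjoint_pair V V' -> {morph V : x y / x + y}.
Proof.
move=> VV' x y; apply: (rdot_inj dot_norm) => z; rewrite !(rdotC _ z).
by rewrite rdotDl /rdot !VV' dotDl scalar_reD.
Qed.

Lemma adjoint_pairZ V V' (a : K) x :
  adjoint_pair V V' -> V (a *: x) = a *: V x.
Proof.
move=> VV'; apply: (rdot_inj dot_norm) => z; rewrite !(rdotC _ z).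
by rewrite /rdot dotZl !VV' dotZl.
Qed.

Lemma adjoint_pair0 V V' : adjoint_pair V V' -> V 0 = 0.
Proof. by move=> VV'; apply: (@addrI _ (V 0)); rewrite -(adjoint_pairD VV') !addr0. Qed.

Lemma adjoint_pairN V V' x : adjoint_pair V V' -> V (- x) = - V x.
Proof. by move=> VV'; rewrite -scaleN1r (adjoint_pairZ _ _ VV') scaleN1r. Qed.

Lemma adjoint_pair_zpow V V' s : bijective V -> bijective V' ->
  adjoint_pair V V' -> adjoint_pair (zpow V s) (zpow V' s).
Proof.
move=> bV bV' VV'.
have it W W' n : adjoint_pair W W' -> adjoint_pair (iter n W) (iter n W').
  by move=> WW'; elim: n => [//|n IH] x y; rewrite iterSr IH WW' -iterS.
case: s => n; apply: it => // x y.
by rewrite -{1}[y](pinvK_bij bV') -VV' pinvK_bij.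
Qed.

Lemma adjointE V V' : adjoint_pair V V' -> adjoint dot V = V'.
Proof.
move=> VV'; apply/funext => y; rewrite /adjoint; case: xgetP => [z _ zP|/(_ (V' y))].
  by apply: (rdot_inj dot_norm) => x; rewrite /rdot -zP VV'.
by case=> x; exact: VV'.
Qed.

(** [|V' x| ^ 2 = <V (V' x), x> <= M |V' x| |x|]. *)
Lemma adjoint_pair_bounded V V' M : adjoint_pair V V' ->
  (forall x, nrm (V x) <= M * nrm x) -> forall x, nrm (V' x) <= M * nrm x.
Proof.
move=> VV' V_le x.
have [->|V0] := eqVneq (nrm (V' x)) 0.
  by apply: le_trans (V_le x); exact: nrm_ge0.
have Vgt : 0 < nrm (V' x) by rewrite lt_neqAle eq_sym V0 nrm_ge0.
rewrite -(ler_pM2r Vgt) -expr2 -(rdotxx dot_norm) /rdot -VV' -/(rdot dot _ _).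
apply: le_trans (ler_norm _) _; apply: le_trans (rdot_CS dot_norm _ _) _.
by rewrite mulrAC ler_wpM2r ?nrm_ge0.
Qed.

(** [representation] with the identity, for the functional
    [x |-> re <V x, y>]. *)
Lemma bounded_adjoint (V : {linear H -> H}) :
  bounded_op V -> adjoint_pair V (adjoint dot V).
Proof.
move=> [M V_le].
have VV' y : exists z, forall x, dot (V x) y = dot x z.
  have [w wP] : exists w, forall x, rdot dot (V x) y = rdot dot x w.
    apply: (@representation R F H dot dot_norm id 1 1 _ _ _ _ _
      (fun x => rdot dot (V x) y) (M * nrm y)) => //.
    - by move=> x; rewrite mul1r.
    - by move=> x; rewrite mul1r.
    - by move=> x z; rewrite linearD rdotDl.
    - by move=> a x; rewrite linearZ rdotZl.
    move=> x; apply: le_trans (ler_norm _) _.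
    apply: le_trans (rdot_CS dot_norm _ _) _.
    by rewrite mulrAC ler_wpM2r ?nrm_ge0.
  by exists w => x; apply: dot_inj_re => a; rewrite -wP linearZ.
move=> x y; rewrite /adjoint; case: xgetP => [z _ ->//|].
by have [z zP] := VV' y => /(_ z).
Qed.

(** [representation] with [V'] itself, for the functional [<., V x0>], gives
    [w] with [V (V' w) = V x0], hence [V' w = x0].  In this way surjectivity
    of [V'] follows from injectivity of [V]. *)
Lemma adjoint_bijective (V : {linear H -> H}) V' c :
  bounded_op V -> injective V -> adjoint_pair V V' -> 0 < c ->
  (forall x, c * nrm x <= nrm (V' x)) -> bijective V'.
Proof.
move=> [M V_le] V_inj VV' c0 V'_ge.
have V'V := adjoint_pair_sym VV'.
have V'_le := adjoint_pair_bounded VV' V_le.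
have /choice[g gK] x0 : exists w, V' w = x0.
  have [w wP] : exists w, forall x, rdot dot x (V x0) = rdot dot (V' x) (V' w).
    apply: (@representation R F H dot dot_norm V' c M (adjoint_pairD V'V)
      (fun a x => adjoint_pairZ _ x V'V) c0
      V'_ge V'_le (fun x => rdot dot x (V x0)) (nrm (V x0))) => //.
    - by move=> x z; rewrite rdotDl.
    - by move=> a x; rewrite rdotZl.
    move=> x; apply: le_trans (ler_norm _) _.
    by apply: le_trans (rdot_CS dot_norm _ _) _; rewrite mulrC.
  exists w; apply: V_inj; apply: (rdot_inj dot_norm) => x; rewrite wP.
  by rewrite /rdot V'V.
exists g => // x; apply/subr0_eq/nrm_eq0/eqP; rewrite eq_le nrm_ge0 andbT.
rewrite -(ler_pM2l c0) mulr0; apply: le_trans (V'_ge _) _.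
rewrite (adjoint_pairD V'V) (adjoint_pairN _ V'V) gK subrr /nrm normr0.
by rewrite -(scalar_of_real0 R F) scalar_re_real.
Qed.

End Adjoints.

(** The increments of a convex sequence are nondecreasing, so a positive first
    increment would make it grow at least linearly. *)
Lemma bounded_convex_le (R : realType) (a : nat -> R) C :
  (forall k, 2 * a k.+1 <= a k.+2 + a k) -> (forall k, a k <= C) -> a 1%N <= a 0%N.
Proof.
move=> conv bnd; rewrite leNgt; apply/negP => a01.
have slope k : a 1%N - a 0%N <= a k.+1 - a k.
  by elim: k => [//|k IH]; have := conv k; lra.
have grow k : a 0%N + k%:R * (a 1%N - a 0%N) <= a k.
  elim: k => [|k IH]; first by rewrite mul0r addr0.
  by have := slope k; rewrite -natr1; lra.
pose k := (Num.truncn ((C - a 0%N) / (a 1%N - a 0%N))).+1.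
have : (C - a 0%N) / (a 1%N - a 0%N) < k%:R by exact: truncnS_gt.
rewrite ltr_pdivrMr ?subr_gt0 //.
by have := grow k; have := bnd k; lra.
Qed.

Section NormalPowerBounded.
Variables (R : realType) (F : scalars).
Notation K := (scalar_field R F).
Variable H : completeNormedModType K.
Variable dot : {dot H for @scalar_conj R F}.
Hypothesis dot_norm : forall x : H, `|x| ^+ 2 = dot x x.

(** With [y = V^k x], [|V y|^2 = <V' V y, y>], and [|V' V y| = |V V y|] as [V]
    is normal; so the squared norms of the [V^k x] form a convex sequence. *)
Lemma normal_power_bounded_contraction (V V' : H -> H) x C :
  adjoint_pair dot V V' -> (forall y, V (V' y) = V' (V y)) ->
  (forall k, nrm (iter k V x) ^+ 2 <= C) -> nrm (V x) <= nrm x.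
Proof.
move=> VV' cVV' bnd; rewrite -ler_sqr ?nnegrE ?nrm_ge0 //.
apply: (@bounded_convex_le _ (fun k => nrm (iter k V x) ^+ 2) C) => // k.
set y := iter k V x; rewrite /= -/y.
have nV z : nrm (V' z) ^+ 2 = nrm (V z) ^+ 2.
  rewrite -!(rdotxx dot_norm) /rdot [in RHS]VV' -cVV'.
  by rewrite (adjoint_pair_sym VV').
rewrite -(nV (V y)) -[in leLHS](rdotxx dot_norm) {1}/rdot VV' -/(rdot _ _ _).
have : 0 <= rdot dot (y - V' (V y)) (y - V' (V y)).
  by rewrite (rdotxx dot_norm) sqr_ge0.
rewrite rdotDl !rdotDr !rdotNl !rdotNr !(rdotxx dot_norm).
rewrite (rdotC _ (V' _)); lra.
Qed.

(** By polarisation [V'] preserves the real inner product, so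
    [V (V' x)] and [x] have the same inner product with every [y]. *)
Lemma isometry_coisometry (V V' : H -> H) : adjoint_pair dot V V' ->
  (forall x, nrm (V' x) = nrm x) -> forall x, V (V' x) = x.
Proof.
move=> VV' iso x; apply: (rdot_inj dot_norm) => y.
have V'V := adjoint_pair_sym VV'.
have e : nrm (V' (y + x)) ^+ 2 = nrm (y + x) ^+ 2 by rewrite iso.
move: e; rewrite (adjoint_pairD dot_norm V'V) -!(rdotxx dot_norm) !rdotDl !rdotDr.
rewrite !(rdotxx dot_norm) !iso !(rdotC _ x y) !(rdotC _ (V' x)).
rewrite {1 2}/rdot V'V -/(rdot _ _ _); lra.
Qed.

End NormalPowerBounded.

(** * Linear recurrences satisfied by two-sided null sequences *)

Section Recurrences.
Variable K : numFieldType.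
Implicit Types (p q : {poly K}) (c : int -> K).

(** The action of [q] on two-sided sequences in which ['X] is the shift; the
    sequences killed by [q] are the solutions of the recurrence with
    characteristic polynomial [q]. *)
Definition shift_act q c (n : int) : K := \sum_(k < size q) q`_k * c (n + k%:Z).

Lemma shift_actE q c n m : (size q <= m)%N ->
  shift_act q c n = \sum_(k < m) q`_k * c (n + k%:Z).
Proof.
move=> qm; rewrite /shift_act (big_ord_widen m (fun k => q`_k * c (n + k%:Z)) qm).
rewrite big_mkcond; apply: eq_bigr => k _; case: ltnP => // kq.
by rewrite nth_default ?mul0r.
Qed.

Lemma shift_act1 c n : shift_act 1 c n = c n.
Proof. by rewrite /shift_act size_poly1 big_ord1 coefC eqxx mul1r addr0. Qed.

Lemma shift_actB p q c n :
  shift_act (p - q) c n = shift_act p c n - shift_act q c n.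
Proof.
pose m := maxn (size p) (size q).
rewrite !(@shift_actE _ _ _ m) ?leq_maxl ?leq_maxr //; last first.
  by apply: leq_trans (size_polyD _ _) _; rewrite size_polyN.
by rewrite -sumrB; apply: eq_bigr => k _; rewrite coefB mulrBl.
Qed.

Lemma shift_actXsubC z q c n : shift_act (('X - z%:P) * q) c n =
  shift_act q (fun n => c (n + 1) - z * c n) n.
Proof.
have sz : (size (('X - z%:P) * q)%R <= (size q).+1)%N.
  by apply: leq_trans (size_polyMleq _ _) _; rewrite size_XsubC.
rewrite (shift_actE _ _ sz).
under eq_bigr do rewrite mulrBl coefB coefXM coefCM mulrBl.
rewrite sumrB big_ord_recl /= mul0r add0r big_ord_recr /= nth_default // mulr0.
rewrite mul0r addr0 -sumrB; apply: eq_bigr => k _.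
rewrite mulrBr mulrCA mulrA; congr (_ * c _ - _).
by rewrite /= /bump /=; lia.
Qed.

Lemma shift_actXnM m q c n : shift_act ('X^m * q) c n = shift_act q c (n + m%:Z).
Proof.
elim: m n => [|m IH] n; first by rewrite expr0 mul1r addr0.
have -> : 'X^(m.+1) * q = ('X - 0%:P) * ('X^m * q).
  by rewrite polyC0 subr0 exprS mulrA.
rewrite shift_actXsubC.
transitivity (shift_act ('X^m * q) c (n + 1)).
  by rewrite /shift_act; apply: eq_bigr => k _; rewrite mul0r subr0 addrAC.
by rewrite IH; congr (shift_act q c _); lia.
Qed.

Lemma shift_actZ a q c n : shift_act (a *: q) c n = a * shift_act q c n.
Proof.
rewrite (@shift_actE _ _ _ (size q)) ?size_scale_leq // mulr_sumr.
by apply: eq_bigr => k _; rewrite coefZ mulrA.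
Qed.

(** Convergence to 0 at both ends, phrased so that it makes sense over
    any [numFieldType] and is visibly invariant under shifts. *)
Definition null_at_infinity c :=
  forall e : K, 0 < e -> finite_set [set n | e <= `|c n|].

Lemma null_at_infinity_shift z c : null_at_infinity c ->
  null_at_infinity (fun n => c (n + 1) - z * c n).
Proof.
move=> c0 e e0.
have z0 : 0 < 2 * (`|z| + 1) by rewrite mulr_gt0 // ltr_wpDl.
have f1 : finite_set [set n | e / 2 <= `|c (n + 1)|].
  apply: (@sub_finite_set _ _ ((fun n => n - 1) @` [set n | e / 2 <= `|c n|])).
    by move=> n /= h; exists (n + 1) => //; rewrite addrK.
  by apply: finite_image; apply: c0; rewrite divr_gt0.
have f2 := c0 _ (divr_gt0 e0 z0).
have f12 : finite_set ([set n | e / 2 <= `|c (n + 1)|] `|`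
    [set n | e / (2 * (`|z| + 1)) <= `|c n|]) by rewrite finite_setU.
apply: sub_finite_set f12 => n /= en.
have [h|h] := real_leP (gtr0_real (divr_gt0 e0 (ltr0Sn K 1))) (normr_real (c (n + 1))).
  by left.
right; rewrite real_leNgt ?normr_real ?gtr0_real ?divr_gt0 //; apply/negP => h'.
have : `|c (n + 1) - z * c n| < e / 2 + e / 2.
  apply: le_lt_trans (ler_normB _ _) _; rewrite normrM.
  apply: ltr_leD => //; apply: le_trans (_ : `|z| * (e / (2 * (`|z| + 1))) <= _).
    by rewrite ler_wpM2l // ltW.
  rewrite mulrA ler_pdivrMr // mulrA divfK ?pnatr_eq0 // mulrC.
  by rewrite ler_wpM2l ?(ltW e0) // lerDl ler01.
by rewrite -splitr => /(le_lt_trans en); rewrite ltxx.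
Qed.

(** One of the two ends contradicts convergence to 0: the right one if
    [1 <= `|z|], the left one otherwise. *)
Lemma null_geometric z c : null_at_infinity c ->
  (forall n, c (n + 1) = z * c n) -> forall n, c n = 0.
Proof.
move=> c0 cz n0; apply/eqP/negPn/negP => cn0.
have absurd (h : nat -> int) : injective h -> ~ (forall k, `|c n0| <= `|c (h k)|).
  move=> h_inj hc; apply: infinite_nat.
  have := c0 _ (_ : 0 < `|c n0|); rewrite normr_gt0 => /(_ cn0) fin.
  have finh := finite_preimage (fun x y _ _ => @h_inj x y) fin.
  by apply: sub_finite_set finh => k _; exact: hc.
have [z1|z1] := real_leP (real1 K) (normr_real z).
  apply: (absurd (fun k => n0 + k%:Z)); first by move=> i j /addrI [].
  elim=> [|k IH]; first by rewrite addr0.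
  by rewrite intS (addrC 1) addrA cz normrM (le_trans IH) // ler_peMl.
apply: (absurd (fun k => n0 - k%:Z)); first by move=> i j /addrI /oppr_inj [].
elim=> [|k IH]; first by rewrite subr0.
apply: le_trans IH _.
have -> : n0 - k%:Z = n0 - k.+1%:Z + 1 by lia.
by rewrite cz normrM ler_piMl // ltW.
Qed.

End Recurrences.

(** Induction on the roots: if [('X - z) q] kills [c] then [q] kills
    [('X - z) c], which is again null at infinity. *)
Lemma null_recurrence_closed (K : numClosedFieldType) (q : {poly K}) c :
  q != 0 -> null_at_infinity c -> (forall n, shift_act q c n = 0) ->
  forall n, c n = 0.
Proof.
move=> q0; have [r qE] := closed_field_poly_normal q.
rewrite qE => c0 qc.
have {}qc n : shift_act (\prod_(z <- r) ('X - z%:P)) c n = 0.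
  by have /eqP := qc n; rewrite shift_actZ mulf_eq0 lead_coef_eq0 (negPf q0) => /eqP.
elim: r c c0 qc {qE} => [|z r IH] c c0 qc n.
  by have := qc n; rewrite big_nil shift_act1.
move: n; apply: (@null_geometric _ z) => // n; apply/subr0_eq.
move: n; apply: (IH (fun n => c (n + 1) - z * c n)).
  exact: null_at_infinity_shift.
by move=> n; have := qc n; rewrite big_cons shift_actXsubC.
Qed.

(** Real sequences are regarded as complex ones. *)
Lemma null_recurrence (R : realType) (F : scalars) (q : {poly scalar_field R F}) c :
  q != 0 -> null_at_infinity c -> (forall n, shift_act q c n = 0) ->
  forall n, c n = 0.
Proof.
case: F q c => /= q c q0 c0 qc n; last exact: (@null_recurrence_closed R[i] q).
suff : (c n)%:C%C = 0 by move/eqP; rewrite eq_complex /= eqxx andbT => /eqP.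
move: n; apply: (@null_recurrence_closed R[i] (map_poly (real_complex R) q)).
- by rewrite map_poly_eq0.
- move=> e e0; have := e0; rewrite ltcE /= => /andP[/eqP ie re].
  apply: sub_finite_set (c0 _ re) => n /=.
  by rewrite normc_def lecE /= => /andP[_]; rewrite expr0n /= addr0 sqrtr_sqr.
move=> n; rewrite /shift_act size_map_poly.
under eq_bigr do rewrite coef_map /= -rmorphM.
rewrite -rmorph_sum -[RHS](rmorph0 (real_complex R)).
by congr (_ _); exact: qc.
Qed.

(** * Orbits that are frames *)

(** If infinitely many terms were at least [e] in modulus, finite partial sums
    of the squares would exceed any bound. *)
Lemma square_summable_null (R : realType) (F : scalars) (a : int -> scalar_field R F) C :
  (\esum_(n in [set: int]) (absv (a n) ^+ 2)%:E <= C%:E)%E -> null_at_infinity a.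
Proof.
move=> aC e e0; have r0 : 0 < scalar_re e.
  by rewrite -(ltr_scalar_of_real F) scalar_of_real0 scalar_of_real_re // ltW.
set r := scalar_re e in r0; apply: contrapT => inf.
have [X XS NX] := infinite_set_fset (Num.truncn (C / r ^+ 2)).+1 inf.
suff : ((C)%:E < \esum_(n in [set: int]) (absv (a n) ^+ 2)%:E)%E by rewrite ltNge aC.
have CX : C < #|` X|%:R * r ^+ 2.
  rewrite -ltr_pdivrMr ?exprn_gt0 //; apply: lt_le_trans (truncnS_gt _) _.
  by rewrite ler_nat.
apply: lt_le_trans (_ : ((#|` X|%:R * r ^+ 2)%:E <= _)%E); first by rewrite lte_fin.
apply: esum_ge; exists [set` X] => //.
rewrite fsbig_finite //= set_fsetK sumEFin lee_fin.
have -> : #|` X|%:R * r ^+ 2 = \sum_(n <- X) r ^+ 2.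
  by rewrite big_const_seq count_predT iter_addr_0 mulr_natl.
rewrite big_seq [leRHS]big_seq; apply: ler_sum => n nX.
rewrite lerXn2r ?nnegrE ?(ltW r0) //.
  by rewrite -(ler_scalar_of_real F) scalar_of_real0 scalar_absv_real.
rewrite -(ler_scalar_of_real F) scalar_absv_real scalar_of_real_re ?(ltW e0) //.
exact: XS.
Qed.

Section FrameOrbit.
Variables (R : realType) (F : scalars).
Notation K := (scalar_field R F).
Variable H : completeNormedModType K.
Variable dot : {dot H for @scalar_conj R F}.
Hypothesis dot_norm : forall x : H, `|x| ^+ 2 = dot x x.
Variables (f : int -> H) (A B : R).
Hypotheses (A_gt0 : 0 < A) (B_gt0 : 0 < B).

Let energy (g : H) : \bar R :=
  \esum_(n in [set: int]) (absv (dot g (f n)) ^+ 2)%:E.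

Hypothesis energy_ge : forall g, ((A * nrm g ^+ 2)%:E <= energy g)%E.
Hypothesis energy_le : forall g, (energy g <= (B * nrm g ^+ 2)%:E)%E.

(** [<V' g, f n> = <g, V (f n)> = <g, f (n + s)>]; reindex by [n + s]. *)
Lemma energy_shift V V' s g : adjoint_pair dot V V' ->
  (forall n, V (f n) = f (n + s)) -> energy (V' g) = energy g.
Proof.
move=> VV' Vf; rewrite /energy [RHS](@reindex_esum _ _ _ setT setT (fun n => n + s)).
  apply: eq_esum => n _.
  by rewrite (adjoint_pair_sym VV') Vf.
split=> // [x y _ _ /addIr //|n _]; by exists (n - s) => //; rewrite subrK.
Qed.

Lemma energy_iter V V' s g k : adjoint_pair dot V V' ->
  (forall n, V (f n) = f (n + s)) -> energy (iter k V' g) = energy g.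
Proof.
by move=> VV' Vf; elim: k => //= k IH; rewrite (energy_shift _ VV' Vf).
Qed.

Lemma norm_sq_equiv V V' s x : adjoint_pair dot V V' ->
  (forall n, V (f n) = f (n + s)) -> A * nrm x ^+ 2 <= B * nrm (V' x) ^+ 2.
Proof.
move=> VV' Vf; rewrite -lee_fin; apply: le_trans (energy_ge _) _.
by rewrite -(energy_shift _ VV' Vf).
Qed.

Lemma iter_bounded V V' s g k : adjoint_pair dot V V' ->
  (forall n, V (f n) = f (n + s)) ->
  nrm (iter k V' g) ^+ 2 <= B * nrm g ^+ 2 / A.
Proof.
move=> VV' Vf; rewrite ler_pdivlMr // mulrC -lee_fin.
by apply: le_trans (energy_ge _) _; rewrite (energy_iter _ _ VV' Vf).
Qed.

Lemma energy_coef_null g : null_at_infinity (fun n => dot (f n) g).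
Proof.
apply: (@square_summable_null _ _ _ (B * nrm g ^+ 2)).
apply: le_trans (energy_le g); rewrite le_eqVlt; apply/orP; left; apply/eqP.
by apply: eq_esum => n _; rewrite dotC absv_conj.
Qed.

(** The lower frame bound makes the orbit complete. *)
Lemma coef_eq0 g : (forall n, dot (f n) g = 0) -> g = 0.
Proof.
move=> g0; apply: nrm_eq0; apply/eqP; rewrite -sqrf_eq0 eq_le sqr_ge0 andbT.
rewrite -(ler_pM2l A_gt0) mulr0 -lee_fin; apply: le_trans (energy_ge _) _.
rewrite /energy esum1 // => n _; rewrite dotC g0.
by rewrite absv_conj absv0 expr0n.
Qed.

Variable T : {linear H -> H}.
Hypotheses (T_bnd : bounded_op T) (T_bij : bijective T).
Hypothesis f_orbit : forall n, f n = zpow T n (f 0).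

Let T' := adjoint dot T.

Lemma zpow_orbit s n : zpow T s (f n) = f (n + s).
Proof. by rewrite [in LHS]f_orbit [RHS]f_orbit addrC zpowD. Qed.

Lemma orbit_adjoint : adjoint_pair dot T T'.
Proof. exact: bounded_adjoint. Qed.

Lemma adjoint_bij : bijective T'.
Proof.
have Tf n : T (f n) = f (n + 1) by rewrite -zpow_orbit.
have AB0 : 0 < A / B by rewrite divr_gt0.
apply: (adjoint_bijective dot_norm T_bnd (bij_inj T_bij) orbit_adjoint
  (c := Num.sqrt (A / B))); first by rewrite sqrtr_gt0.
move=> x; rewrite -ler_sqr ?nnegrE ?mulr_ge0 ?nrm_ge0 ?sqrtr_ge0 //.
rewrite exprMn sqr_sqrtr ?(ltW AB0) // mulrAC ler_pdivrMr // [leRHS]mulrC.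
exact: (norm_sq_equiv _ orbit_adjoint Tf).
Qed.

Lemma adjoint_pair_power s : adjoint_pair dot (zpow T s) (zpow T' s).
Proof. exact: adjoint_pair_zpow T_bij adjoint_bij orbit_adjoint. Qed.

(** The contraction property for [T' ^ s] and for its inverse makes [T' ^ s]
    isometric; the powers [- s] commute because the powers [s] do. *)
Lemma commute_unitary s :
  (forall x, zpow T s (zpow T' s x) = zpow T' s (zpow T s x)) ->
  forall x, zpow T s (zpow T' s x) = x.
Proof.
move=> comm; apply: (isometry_coisometry dot_norm (adjoint_pair_power s)) => x.
have contr t y : (forall z, zpow T t (zpow T' t z) = zpow T' t (zpow T t z)) ->
    nrm (zpow T' t y) <= nrm y.
  move=> commt; apply: (normal_power_bounded_contraction dot_norm
    (adjoint_pair_sym (adjoint_pair_power t))) => [z|k].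
    by rewrite commt.
  exact: (iter_bounded _ _ (adjoint_pair_power t) (zpow_orbit t)).
apply/eqP; rewrite eq_le contr //=.
rewrite -{1}(zpowK adjoint_bij s x) contr // => z.
apply: (can_inj (zpowK T_bij s)); apply: (can_inj (zpowK adjoint_bij s)).
have K1 y : zpow T s (zpow T (- s) y) = y by rewrite -zpowD // subrr.
have K2 y : zpow T' s (zpow T' (- s) y) = y.
  by rewrite -zpowD ?subrr //; exact: adjoint_bij.
by rewrite K1 K2 -comm K2 K1.
Qed.

Lemma unitary_of_normal s :
  normal_op dot (zpow T s) -> unitary_op dot (zpow T s).
Proof.
rewrite /normal_op /unitary_op (adjointE dot_norm (adjoint_pair_power s)) => comm.
have TT' x : zpow T s (zpow T' s x) = x.
  by apply: commute_unitary => y; exact: (congr1 (@^~ y) comm).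
by rewrite -comm; split; apply/funext => x /=; exact: TT'.
Qed.

Lemma no_polynomial_relation (q : {poly K}) : q != 0 ->
  (exists x : H, x <> 0) ->
  ~ (forall g n, shift_act q (fun n => dot (f n) g) n = 0).
Proof.
move=> q0 [x x0] qf; apply: x0; apply: coef_eq0.
exact: null_recurrence q0 (energy_coef_null _) (qf x).
Qed.

(** Applying [p] to [T] along the orbit is applying [p] to the shift. *)
Lemma poly_op_orbit (p : {poly K}) n g :
  dot (poly_op p T (f n)) g = shift_act p (fun n => dot (f n) g) n.
Proof.
rewrite /poly_op /shift_act.
apply: (big_ind2 (fun u v => dot u g = v)) => [|x1 x2 y1 y2 <- <-|k _].
- by rewrite linear0l.
- by rewrite dotDl.
by rewrite dotZl -zpow_orbit.
Qed.

Lemma poly_op_zpow (p : {poly K}) s x :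
  zpow T s (poly_op p T x) = poly_op p T (zpow T s x).
Proof.
have PP' := adjoint_pair_power s.
rewrite /poly_op.
apply: (big_ind2 (fun u v => zpow T s u = v)) => [|x1 x2 y1 y2 <- <-|k _].
- exact: (adjoint_pair0 dot_norm PP').
- exact: (adjoint_pairD dot_norm PP').
rewrite (adjoint_pairZ dot_norm _ _ PP').
have it y : iter k T y = zpow T k%:Z y by [].
by rewrite !it -!zpowD // addrC.
Qed.

(** The relation [T^s p(T) = 1] has the characteristic polynomial
    ['X^s * p - 1] for [0 <= s] and [p - 'X^(- s)] for [s < 0].  The former is
    nonzero for [0 < s] as its constant coefficient is [-1]; otherwise the
    hypothesis on [p] makes it nonzero. *)
Lemma adjoint_power_neq_poly s (p : {poly K}) : (exists x : H, x <> 0) ->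
  (0 < s \/ p <> 'X^`|s|%N) -> zpow T' s <> poly_op p T.
Proof.
move=> H0 sp E.
have inv n : zpow T s (poly_op p T (f n)) = f n.
  rewrite -E; apply: commute_unitary => x.
  by rewrite E poly_op_zpow.
have rel g n : shift_act p (fun n => dot (f n) g) n = dot (f (n - s)) g.
  by rewrite -poly_op_orbit -zpow_orbit -{2}(inv n) zpowK.
case: s E sp inv rel => m E sp inv rel.
  apply: (@no_polynomial_relation ('X^m * p - 1)) => //.
    rewrite subr_eq0; apply/eqP; case: m sp {E inv rel} => [|m] sp.
      by rewrite expr0 mul1r => p1; case: sp => //; rewrite expr0.
    move=> /(congr1 (fun q : {poly K} => q`_0)); rewrite coefXnM coef1 /=.
    by move/eqP; rewrite eq_sym oner_eq0.
  by move=> g n; rewrite shift_actB shift_act1 shift_actXnM rel addrK subrr.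
apply: (@no_polynomial_relation (p - 'X^(m.+1))) => //.
  by rewrite subr_eq0; apply/eqP; case: sp.
move=> g n; rewrite shift_actB rel -['X^_]mulr1 shift_actXnM shift_act1.
by rewrite NegzE opprK subrr.
Qed.

End FrameOrbit.

(* In (ii) the pairs with s <= 0 and p = X^|s| are left out: the identity
   (T^* )^s = T^|s| does hold for such s whenever T is unitary. *)
Theorem corollary2p4 (R : realType) (F : scalars)
    (H : completeNormedModType (scalar_field R F))
    (dot : {dot H for @scalar_conj R F})
    (dot_norm : forall x : H, `|x| ^+ 2 = dot x x)
    (H_separable : separable H)
    (f : int -> H) (f_frame : frame dot f)
    (T : {linear H -> H}) (T_GL : GL T)
    (f_orbit : forall n : int, f n = zpow T n (f 0)) :
  (forall s : int, normal_op dot (zpow T s) -> unitary_op dot (zpow T s)) /\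
  ((exists x : H, x <> 0) ->
    (forall (s : int) (p : {poly scalar_field R F}),
       (0 < s \/ p <> 'X^`|s|%N) -> zpow (adjoint dot T) s <> poly_op p T) /\
    ~ self_adjoint dot T).
Proof.
have [A [B [A0 B0 fAB]]] := f_frame; have [T_bnd T_bij] := T_GL.
have E_ge g := (fAB g).1; have E_le g := (fAB g).2.
split=> [s|H0].
  exact: (unitary_of_normal dot_norm A0 B0 E_ge E_le T_bnd T_bij f_orbit).
have neq := adjoint_power_neq_poly dot_norm A0 B0 E_ge E_le T_bnd T_bij f_orbit.
split=> [s p|TT]; first exact: neq.
(* A self-adjoint [T] would be [(T* )^1 = p(T)] with [p = 'X]. *)
apply: (neq 1 'X H0); first by left.
apply/funext => x; rewrite TT /poly_op size_polyX !big_ord_recl big_ord0 !coefX.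
by rewrite scale0r scale1r add0r addr0.
Qed.
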